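(* Let $m$ be a positive even integer, $k,i$ positive integers, $s,u$ integers, $Q=2^{m}+1$, $K=2^{k}$. Assume $\gcd(i,Q)=1$, $\gcd(K+1,Q)=1$, $\gcd(K+2s+1,Q)=1$, and $\gcd(d_{1},2^{2m}-1)=1$, where $d_{1}=(K+2s+1)i+uQ$, $d_{2}=(K+2s+1)i+uQ+(Q-2)i$, $d_{3}=(K+2s+1)i+uQ+(Q-2)si$, $d_{4}=(K+2s+1)i+uQ+(Q-2)(s+1)i$, $d_{5}=(K+2s+1)i+uQ+(Q-2)2si$, $d_{6}=(K+2s+1)i+uQ+(Q-2)(2s+1)i$, $d_{7}=(K+2s+1)i+uQ+(Q-2)Ki$, $d_{8}=(K+2s+1)i+uQ+(Q-2)(K+s)i$, $d_{9}=(K+2s+1)i+uQ+(Q-2)(K+2s)i$. Then $\sum_{j=1}^{9}x^{d_{j}}$ is a permutation polynomial over $\mathbb{F}_{2^{2m}}$.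
   Context: A polynomial $f$ is a permutation polynomial over $\mathbb{F}_{q}$ if $x\mapsto f(x)$ is a bijection of $\mathbb{F}_q$. Integer exponents are understood modulo $2^{2m}-1=Q(Q-2)$, i.e. $x^{d}$ means $x^{d \bmod (2^{2m}-1)}$. *)

(* Defs.v *)
From HB Require Import structures.
From mathcomp Require Import all_boot all_order all_algebra all_field.

Set Implicit Arguments.
Unset Strict Implicit.
Unset Printing Implicit Defensive.

Import GRing.Theory.
Local Open Scope ring_scope.

Definition permutation_polynomial (F : finFieldType) (f : {poly F}) : Prop :=
  bijective (fun x : F => f.[x]).

(* The exponent is an arbitrary (possibly negative) integer, replaced by its
   representative in [0, #|F| - 1); the value of (_ %% _)%Z is non-negative for
   a nonzero modulus, so the absolute value only casts it to nat. *)
Definition zmonomial (F : finFieldType) (d : int) : {poly F} :=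
  'X^(`|(d %% #|F|.-1)%Z|%N).

(* Main.v *)
Require Import Defs.
From HB Require Import structures.
From mathcomp Require Import all_boot all_order all_algebra all_field.
From mathcomp Require Import fingroup pgroup zify ring.

(* Put q = 2^m, so that Q = q + 1. For nonzero x and y = x^((q - 1) i), which
   lies in the group mu of (q + 1)-st roots of unity, the polynomial takes the
   value f(x) = x^d1 D E with D = y^K + y + 1 and E = 1 + y^s + y^(2s). As the
   q-th power inverts y, one gets f(x)^q D = f(x) N with
   N = y^(K + 1) + y^K + y, so f(x) determines N / D whenever D and E do not
   vanish. Let w be a primitive cube root of unity; it is fixed by the q-th
   power because m is even, hence is not in mu, and this gives D != 0 and
   E != 0. In terms of t = (y + w) / (y + w^2), the fraction
   (N + w D) / (N + w^2 D) is t^(-(K + 1)) if k is even and t^(K - 1) if k is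
   odd. Quotients of two such t lie in mu, on which both powers are injective,
   so f(x) determines y, hence also x^d1, and finally x. *)

Set Implicit Arguments.
Unset Strict Implicit.
Unset Printing Implicit Defensive.

Import Order.TTheory GRing.Theory Num.Theory.
Local Open Scope ring_scope.

Lemma expfz_coprime_eq1 (F : fieldType) (w : F) (a b : int) :
  w != 0 -> coprimez a b -> w ^ a = 1 -> w ^ b = 1 -> w = 1.
Proof.
move=> w0 /coprimezP[[u v] /= uv] wa wb.
rewrite -[w]expr1z -uv expfzDr // (mulrC u) (mulrC v).
by rewrite -!exprz_exp wa wb !exp1rz mulr1.
Qed.

Lemma exp2_even_mod3 m : ~~ odd m -> (2 ^ m = 1 %[mod 3])%N.
Proof.
move=> m_even; rewrite -[m]odd_double_half (negPf m_even) add0n -mul2n expnM.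
by rewrite -modnXm exp1n.
Qed.

(** * Cube roots of unity and the fraction [N / D] in characteristic two *)

Section CharacteristicTwo.

Variables (F : fieldType).
Hypothesis F2 : 2 \in [pchar F].

Let two0 : 2%:R = 0 :> F. Proof. exact: pcharf0. Qed.

Lemma cube_root1_neq1 (w : F) : w ^+ 2 = w + 1 -> w != 1.
Proof.
move=> ww; apply/eqP => w1; move: ww (oner_neq0 F) => /eqP.
by rewrite w1 expr1n addrr_pchar2 // => ->.
Qed.

Lemma cube_root1_exp3 (w : F) : w ^+ 2 = w + 1 -> w ^+ 3 = 1.
Proof. by move=> ww; ring: two0 ww. Qed.

Lemma cube_root1_exp2X (w : F) n :
  w ^+ 2 = w + 1 -> w ^+ (2 ^ n) = if odd n then w + 1 else w.
Proof.
move=> ww; elim: n => [|n IHn]; first by rewrite expr1.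
rewrite expnSr exprM IHn /=; case: (odd n) => /=; ring: two0 ww.
Qed.

Lemma exprD_2X (x y : F) n : (x + y) ^+ (2 ^ n) = x ^+ (2 ^ n) + y ^+ (2 ^ n).
Proof. by apply: exprDn_pchar; rewrite pnatX pnatE // F2. Qed.

(** Otherwise [y ^+ 3 = 1] and, [m] being even, [y ^+ (2 ^ m) = y]; then [y ^+ 2 = 1] as well, which
    forces [y = 1]. *)
Lemma cube_root1_exp_neq1 (y : F) m :
  ~~ odd m -> y ^+ (2 ^ m).+1 = 1 -> y ^+ 2 != y + 1.
Proof.
move=> m_even yQ; apply/eqP => yy; have := cube_root1_neq1 yy.
have := cube_root1_exp2X m yy; rewrite (negPf m_even) => yq.
move: (cube_root1_exp3 yy).
by rewrite exprS yq -expr2 in yQ; rewrite exprS yQ mulr1 => ->; rewrite eqxx.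
Qed.

(** The power [K] is additive and sends [w] to [w] or [w + 1] according to the parity of [k]. *)
Lemma cube_root1_factor (w y : F) k (K := (2 ^ k)%N) :
  w ^+ 2 = w + 1 ->
  let N := y ^+ K.+1 + y ^+ K + y in
  let D := y ^+ K + y + 1 in
  let a := y + w in let b := y + w + 1 in
  N + w * D = (if odd k then a else b) ^+ K * b /\
  N + (w + 1) * D = (if odd k then b else a) ^+ K * a.
Proof.
move=> ww /=; rewrite !(fun_if (fun x => x ^+ K)) !exprD_2X !exprS.
rewrite !expr1n (cube_root1_exp2X k ww).
by case: (odd k); split; ring: two0 ww.
Qed.

(** The power [2 ^ m] inverts [y], and [y ^+ K.+1] clears the denominators. *)
Lemma denominator_conj (y : F) m k (K := (2 ^ k)%N) :
  y ^+ (2 ^ m).+1 = 1 ->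
  (y ^+ K + y + 1) ^+ (2 ^ m) * y ^+ K.+1 = y ^+ K.+1 + y ^+ K + y.
Proof.
rewrite !exprS !exprD_2X expr1n -exprM mulnC exprM.
move: (y ^+ (2 ^ m)) => z yz; have yzK : y ^+ K * z ^+ K = 1.
  by rewrite -exprMn yz expr1n.
move: (y ^+ K) (z ^+ K) yzK => P Z PZ; ring: yz PZ.
Qed.

(** If [D] vanished, so would its conjugate [N], hence both products in [cube_root1_factor]; but
    [(y + w) * (y + w + 1) = y ^+ 2 + y + 1] is nonzero. *)
Lemma denominator_neq0 (w y : F) m k (K := (2 ^ k)%N) :
  w ^+ 2 = w + 1 -> ~~ odd m -> y ^+ (2 ^ m).+1 = 1 ->
  y ^+ K + y + 1 != 0.
Proof.
move=> ww m_even yQ; apply/eqP => D0.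
have := denominator_conj k yQ; rewrite D0 expr0n expn_eq0 /= mul0r => N0.
have [] := cube_root1_factor y k ww; rewrite /= D0 -N0 !mulr0 addr0.
have: (y + w) * (y + w + 1) != 0.
  have -> : (y + w) * (y + w + 1) = y ^+ 2 + (y + 1) by ring: two0 ww.
  by rewrite addr_eq0 oppr_pchar2 // (cube_root1_exp_neq1 m_even yQ).
rewrite mulf_eq0 negb_or => /andP[a0 b0] /esym/eqP.
by rewrite mulf_eq0 expf_eq0 (negPf b0) orbF; case: (odd k);
  rewrite (negPf a0, negPf b0) andbF.
Qed.

Lemma fraction_inj (w y1 y2 : F) m k (q := (2 ^ m)%N) (K := (2 ^ k)%N) :
  w ^+ 2 = w + 1 -> ~~ odd m -> coprime K.+1 q.+1 ->
  y1 ^+ q.+1 = 1 -> y2 ^+ q.+1 = 1 ->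
  (y1 ^+ K.+1 + y1 ^+ K + y1) * (y2 ^+ K + y2 + 1) =
  (y2 ^+ K.+1 + y2 ^+ K + y2) * (y1 ^+ K + y1 + 1) -> y1 = y2.
Proof.
move=> ww m_even coKQ y1Q y2Q.
have ab0 (y : F) : y ^+ q.+1 = 1 -> (y + w != 0) && (y + w + 1 != 0).
  move=> yQ; rewrite -negb_or -mulf_eq0.
  have -> : (y + w) * (y + w + 1) = y ^+ 2 + (y + 1) by ring: two0 ww.
  by rewrite addr_eq0 oppr_pchar2 // (cube_root1_exp_neq1 m_even yQ).
have /andP[a10 b10] := ab0 _ y1Q; have /andP[a20 b20] := ab0 _ y2Q.
have neq0 (y : F) : y ^+ q.+1 = 1 -> y != 0.
  move=> yQ; apply/eqP => y0; move/eqP: yQ.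
  by rewrite y0 exprS mul0r eq_sym oner_eq0.
have [y10 y20] := (neq0 _ y1Q, neq0 _ y2Q).
have wq : w ^+ q = w by rewrite /q cube_root1_exp2X // (negPf m_even).
(* The [q]-th power exchanges [y + w] and [y + w + 1] up to factors that cancel in the quotient [t]
   below, so it inverts [t]. *)
have conj_ab (y : F) : y ^+ q.+1 = 1 ->
    (y + w) ^+ q * y = w * (y + w + 1) /\
    (y + w + 1) ^+ q * y = (w + 1) * (y + w).
  rewrite exprS !exprD_2X expr1n -/q wq; move: (y ^+ q) => z yz.
  by split; ring: two0 ww yz.
have [A1 B1] := conj_ab _ y1Q; have [A2 B2] := conj_ab _ y2Q.
have [NA1 NB1] := cube_root1_factor y1 k ww.
have [NA2 NB2] := cube_root1_factor y2 k ww.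
move: (y1 ^+ K.+1 + y1 ^+ K + y1) (y1 ^+ K + y1 + 1) NA1 NB1 => N1 D1 NA1 NB1.
move: (y2 ^+ K.+1 + y2 ^+ K + y2) (y2 ^+ K + y2 + 1) NA2 NB2 => N2 D2 NA2 NB2.
move=> N12.
have AB : (N1 + w * D1) * (N2 + (w + 1) * D2) =
          (N2 + w * D2) * (N1 + (w + 1) * D1) by ring: N12 two0 ww.
(* The quotient of the values of [(y + w) / (y + w + 1)] at [y1] and [y2]; here [w + 1 = w ^+ 2]. *)
pose t := (y1 + w) * (y2 + w + 1) / ((y2 + w) * (y1 + w + 1)).
have den0 : (y2 + w) * (y1 + w + 1) != 0 by rewrite mulf_neq0.
have num0 : (y1 + w) * (y2 + w + 1) != 0 by rewrite mulf_neq0.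
have t0 : t != 0 by rewrite mulf_neq0 ?invr_neq0.
have tQ : t ^+ q.+1 = 1.
  rewrite exprMn exprVn; apply: (canLR (mulfK _)); rewrite ?expf_neq0 // mul1r.
  apply: (mulIf y10); apply: (mulIf y20); rewrite !exprS !exprMn.
  move: (_ ^+ q) (_ ^+ q) (_ ^+ q) (_ ^+ q) A1 B1 A2 B2 => ? ? ? ? A1 B1 A2 B2.
  by ring: A1 B1 A2 B2.
suff t1 : t = 1.
  have e : (y1 + w) * (y2 + w + 1) = (y2 + w) * (y1 + w + 1).
    by rewrite -[LHS](divfK den0) -/t t1 mul1r.
  have y1E : y1 = y2 + ((y1 + w) * (y2 + w + 1) - (y2 + w) * (y1 + w + 1)).
    by ring.
  by rewrite y1E e subrr addr0.
move: AB; rewrite NA1 NA2 NB1 NB2; case: ifP => k_odd AB.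
  have tK : t ^+ K = t.
    rewrite exprMn exprVn; apply: (canLR (mulfK _)); rewrite ?expf_neq0 //.
    apply: (mulIf den0); rewrite mulrAC divfK // !exprMn.
    move: AB;
    move: (y1 + w) (y2 + w) (y1 + w + 1) (y2 + w + 1)
      (_ ^+ K) (_ ^+ K) (_ ^+ K) (_ ^+ K) => ? ? ? ? ? ? ? ? AB; ring: AB.
  (* [t ^+ q = t^-1] gives [t ^+ (q ^ k) = t^-1] as [k] is odd, while
     [q ^ k = K ^ m] and [t ^+ K = t]; so [t ^+ 2 = 1]. *)
  have tV : t ^+ q = t^-1 by apply: (mulfI t0); rewrite -exprS tQ mulfV.
  have tqX n : t ^+ (q ^ n) = if odd n then t^-1 else t.
    elim: n => [|n IHn]; first by rewrite expr1.
    by rewrite expnS exprM tV exprVn IHn /=; case: (odd n); rewrite ?invrK.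
  have tKX n : t ^+ (K ^ n) = t.
    by elim: n => [|n IHn]; rewrite ?expr1 // expnS exprM tK.
  have := tqX k; rewrite /q -expnM mulnC expnM tKX k_odd => tVt.
  have /eqP : t ^+ 2 = 1 by rewrite expr2 {1}tVt mulVf.
  by rewrite sqrf_eq1 oppr_pchar2 // orbb => /eqP.
have tK : t ^+ K.+1 = 1.
  rewrite exprMn exprVn; apply: (canLR (mulfK _)); rewrite ?expf_neq0 // mul1r.
  rewrite !exprS !exprMn; move: AB.
  move: (y1 + w) (y2 + w) (y1 + w + 1) (y2 + w + 1)
    (_ ^+ K) (_ ^+ K) (_ ^+ K) (_ ^+ K) => ? ? ? ? ? ? ? ? AB; ring: AB.
by apply: (@expfz_coprime_eq1 _ t K.+1 q.+1) => //; rewrite coprimezE.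
Qed.

End CharacteristicTwo.

(** * Finite fields: existence of [w] and evaluation of monomials *)

Lemma cube_root1_exists (F : finFieldType) :
  2 \in [pchar F] -> (3 %| #|F|.-1)%N -> exists w : F, w ^+ 2 = w + 1.
Proof.
move=> F2; rewrite -card_finField_unit => /(@Cauchy _ 3 _ isT)[x _ ox].
exists (val x); have x1 : val x != 1.
  apply: contra_eq_neq ox => x1.
  by rewrite (_ : x = 1%g) ?order1 //; exact: val_inj.
have x3 : val x ^+ 3 = 1 by rewrite -FinRing.val_unitX -ox expg_order.
(* In characteristic two, [x ^+ 3 + 1] is [(x + 1) * (x ^+ 2 + x + 1)], and the first factor is
   nonzero. *)
apply: (mulfI (x := val x + 1)); first by rewrite addr_eq0 oppr_pchar2.
by have two0 := pcharf0 F2; ring: two0 x3.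
Qed.

Lemma expf_card_pred (F : finFieldType) (x : F) : x != 0 -> x ^+ #|F|.-1 = 1.
Proof.
move=> x0; apply: (mulfI x0).
by rewrite -exprS prednK ?expf_card ?mulr1 // ltnW ?finNzRing_gt1.
Qed.

Lemma horner_zmonomial (F : finFieldType) (d : int) (x : F) :
  x != 0 -> (zmonomial F d).[x] = x ^ d.
Proof.
move=> x0; have N0 : (#|F|.-1%:Z != 0).
  by case: #|F| (finNzRing_gt1 F) => [|[|n]].
rewrite hornerXn exprnP gez0_abs ?modz_ge0 // [in RHS](divz_eq d #|F|.-1).
rewrite [RHS]expfzDr // (mulrC (_ %/ _)%Z) -exprz_exp.
by rewrite -[x ^ (_.-1)%:Z]/(x ^+ _) expf_card_pred // exp1rz mul1r.
Qed.

Lemma horner_zmonomial0 (F : finFieldType) (d : int) :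
  ~~ (#|F|.-1 %| d)%Z -> (zmonomial F d).[0] = 0.
Proof.
move=> /dvdz_mod0P/eqP dN; by rewrite hornerXn expr0n absz_eq0 (negPf dN).
Qed.

Theorem theorem4 (F : finFieldType) (m k i : nat) (s u : int) :
  (0 < m)%N -> ~~ odd m -> (0 < k)%N -> (0 < i)%N ->
  #|F| = (2 ^ (2 * m))%N ->
  let Q : int := 2 ^+ m + 1 in
  let K : int := 2 ^+ k in
  let d1 : int := (K + 2 * s + 1) * i%:Z + u * Q in
  let d2 : int := (K + 2 * s + 1) * i%:Z + u * Q + (Q - 2) * i%:Z in
  let d3 : int := (K + 2 * s + 1) * i%:Z + u * Q + (Q - 2) * s * i%:Z in
  let d4 : int := (K + 2 * s + 1) * i%:Z + u * Q + (Q - 2) * (s + 1) * i%:Z in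
  let d5 : int := (K + 2 * s + 1) * i%:Z + u * Q + (Q - 2) * (2 * s) * i%:Z in
  let d6 : int := (K + 2 * s + 1) * i%:Z + u * Q + (Q - 2) * (2 * s + 1) * i%:Z in
  let d7 : int := (K + 2 * s + 1) * i%:Z + u * Q + (Q - 2) * K * i%:Z in
  let d8 : int := (K + 2 * s + 1) * i%:Z + u * Q + (Q - 2) * (K + s) * i%:Z in
  let d9 : int := (K + 2 * s + 1) * i%:Z + u * Q + (Q - 2) * (K + 2 * s) * i%:Z in
  coprimez i%:Z Q ->
  coprimez (K + 1) Q ->
  coprimez (K + 2 * s + 1) Q ->
  coprimez d1 (2 ^+ (2 * m) - 1) ->
  permutation_polynomial
    (\sum_(d <- [:: d1; d2; d3; d4; d5; d6; d7; d8; d9]) zmonomial F d).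
Proof.
move=> m_gt0 m_even k_gt0 i_gt0 cardF Q K d1 d2 d3 d4 d5 d6 d7 d8 d9.
move=> coiQ coKQ _ co_d1.
pose q := (2 ^ m)%N.
have QE : Q = q.+1 by rewrite /Q -natrX natz -/q; lia.
have KE : K = (2 ^ k)%N by rewrite /K -natrX natz.
have q_gt1 : (1 < q)%N by rewrite -{1}(expn0 2) ltn_exp2l.
have qmod3 : (q = 1 %[mod 3])%N by exact: exp2_even_mod3.
have cardFq : #|F| = (q * q)%N by rewrite cardF mul2n -addnn expnD.
have NE : 2 ^+ (2 * m) - 1 = #|F|.-1 :> int.
  by rewrite -natrX natz -cardF; have := finNzRing_gt1 F; lia.
have NQE : #|F|.-1%:Z = Q * (Q - 2) by rewrite QE cardFq; lia.
have F2 : 2 \in [pchar F] by exact: card_finPcharP cardF _.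
have [|w ww] := cube_root1_exists F2.
  have : (q * q = 1 %[mod 3])%N by rewrite -modnMml qmod3 mul1n.
  by rewrite cardFq => /eqP; rewrite eqn_mod_dvd ?subn1 // muln_gt0; lia.
pose y (x : F) := x ^ ((Q - 2) * i).
pose E (x : F) := 1 + y x ^ s + (y x ^ s) ^+ 2.
set f := \sum_(_ <- _) _.
(* The nine exponents are [d1 + (Q - 2) * e * i], where [e] is the sum of one of [0, 1, K] and one
   of [0, s, 2 * s]; hence the product form. *)
have fE x : x != 0 ->
  f.[x] = x ^ d1 * (y x ^+ (2 ^ k) + y x + 1) * E x.
  move=> x0; rewrite /f horner_sum !big_cons big_nil addr0 !horner_zmonomial //.
  have y0 : y x != 0 by rewrite expfz_neq0.
  have dE d : x ^ (d1 + (Q - 2) * d * i) = x ^ d1 * y x ^ d.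
    by rewrite expfzDr // mulrAC -exprz_exp.
  have v2 : y x ^ (2 * s) = (y x ^ s) ^+ 2 by rewrite mulrC -exprz_exp.
  rewrite -[d2]/(d1 + (Q - 2) * i) -{1}[Q - 2]mulr1 !dE !(expfzDr _ _ y0) v2.
  rewrite expr1z /E KE -[y x ^ Posz _]/(y x ^+ _).
  ring.
have yQ x : x != 0 -> y x ^+ q.+1 = 1.
  move=> x0; rewrite exprnP exprz_exp -QE mulrAC [_ * Q]mulrC -NQE -exprz_exp.
  by rewrite -[x ^ _]exprnP expf_card_pred // exp1rz.
have vQ x : x != 0 -> (y x ^ s) ^+ q.+1 = 1.
  by move=> x0; rewrite exprnP exprzAC -exprnP yQ // exp1rz.
have D0 x : x != 0 -> y x ^+ (2 ^ k) + y x + 1 != 0.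
  by move=> x0; apply: denominator_neq0 ww m_even _ => //; exact: yQ.
have E0 x : x != 0 -> E x != 0.
  move=> x0; rewrite /E addrC addr_eq0 oppr_pchar2 // addrC.
  by apply: cube_root1_exp_neq1 m_even _ => //; exact: vQ.
have fq x : x != 0 -> f.[x] ^+ q * (y x ^+ (2 ^ k) + y x + 1) =
    f.[x] * (y x ^+ (2 ^ k).+1 + y x ^+ (2 ^ k) + y x).
  move=> x0; rewrite -(denominator_conj F2 k (yQ x x0)) fE // !exprMn -/q.
  have -> : (x ^ d1) ^+ q = x ^ d1 * (y x ^+ (2 ^ k).+1 * (y x ^ s) ^+ 2).
    have y0 : y x != 0 by rewrite expfz_neq0.
    rewrite exprnP exprz_exp.
    (* Expand [d1 * (Q - 2)]: its [u] part is a multiple of the group order [Q * (Q - 2)], and the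
       rest contributes [y x ^ (K + 2 * s + 1)]. *)
    have -> : d1 * q = d1 + #|F|.-1%:Z * u + (Q - 2) * i * (K + (s * 2 + 1)).
      have -> : q%:Z = Q - 1 by rewrite QE; lia.
      by rewrite NQE /d1; ring.
    rewrite !(expfzDr _ _ x0) -[x ^ (_ * u)]exprz_exp.
    rewrite -[x ^ (_ * (K + _))]exprz_exp.
    rewrite -/(y x) !(expfzDr _ _ y0) -[_ ^ (s * 2)]exprz_exp.
    rewrite KE -[x ^ (_.-1)%:Z]/(x ^+ _) expf_card_pred // exp1rz mulr1 expr1z.
    rewrite -[y x ^ Posz _]/(y x ^+ _) -[_ ^ 2]/((y x ^ s) ^+ 2).
    by rewrite (exprS (y x)); ring.
  (* [E] is palindromic in [y x ^ s], which the [q]-th power inverts. *)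
  have Eq : E x ^+ q * (y x ^ s) ^+ 2 = E x.
    rewrite /E !(exprD_2X F2) expr1n -exprM mulnC exprM.
    move: (vQ x x0); rewrite exprS -/q; move: (y x ^ s) (_ ^+ q) => v z vz.
    ring: vz.
  by rewrite -[in RHS]Eq; ring.
(* An exponent divisible by [#|F|.-1] would be reduced to [0], adding [1] to
   [f.[0]]. *)
have N_ndvd d : ~~ (#|F|.-1 %| d1 + (Q - 2) * d * i)%Z.
  (* Otherwise [Q - 2] divides [d1], so coprimality makes it a unit; this means [q = 2], contrary to
     [q = 1] modulo [3]. *)
  rewrite NQE; apply/negP => /(dvdz_trans (dvdz_mull Q (dvdzz (Q - 2)))).
  rewrite -mulrA rpredDr ?dvdz_mulr // => Qd1.
  have := co_d1; rewrite NE NQE coprimezMr => /andP[_ /coprimezP[[a b] /= ab]].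
  have: (Q - 2 %| a * d1 + b * (Q - 2))%Z by rewrite rpredD ?dvdz_mull.
  by rewrite ab dvdz1 QE => /eqP; lia.
have f0 : f.[0] = 0.
  have d0 : d1 = d1 + (Q - 2) * 0 * i by ring.
  have d2E : d2 = d1 + (Q - 2) * 1 * i by rewrite mulr1.
  rewrite /f horner_sum !big_cons big_nil {1}d0 d2E.
  by rewrite !horner_zmonomial0 ?N_ndvd // !addr0.
have fn0 x : x != 0 -> f.[x] != 0.
  by move=> x0; rewrite fE // !mulf_neq0 ?D0 ?E0 ?expfz_neq0.
apply: injF_bij => x1 x2 /= f12.
have [x10|x10] := eqVneq x1 0.
  apply/eqP; rewrite x10 eq_sym; apply/negPn/negP => /fn0.
  by rewrite -f12 x10 f0 eqxx.
have [x20|x20] := eqVneq x2 0.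
  by have := fn0 _ x10; rewrite f12 x20 f0 eqxx.
have y12 : y x1 = y x2.
  apply: (fraction_inj F2 (k := k) ww m_even _ (yQ _ x10) (yQ _ x20)).
    by move: coKQ; rewrite KE QE coprimezE; congr coprime; lia.
  (* By [fq], each fraction [N / D] equals [f.[x] ^+ q / f.[x]]. *)
  apply: (mulfI (fn0 _ x10)); rewrite !mulrA -fq // f12 -fq // -f12; ring.
have : x1 ^ d1 = x2 ^ d1.
  have := f12; rewrite !fE // /E y12 => e.
  by apply: (mulIf (D0 _ x20)); apply: (mulIf (E0 _ x20)).
move=> e; have x120 : x1 / x2 != 0 by rewrite mulf_neq0 ?invr_neq0.
have : x1 / x2 = 1.
  apply: (expfz_coprime_eq1 x120 co_d1).
    by rewrite expfzMl e -expfzMl divff // exp1rz.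
  by rewrite NE -exprnP expf_card_pred //.
by move/(canRL (divfK x20)); rewrite mul1r.
Qed.
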